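(* Suppose $\Gamma$ is a finite, connected, triangle-free and square-free graph without any degree-one or degree-zero vertex. Then for each finite-index subgroup $G$ of $A(\Gamma)$, we have $G^e\cong\Gamma^e$ as graphs.
   Context: Graphs are simplicial. Triangle-free (square-free) means no induced subgraph is a $3$-cycle ($4$-cycle). $A(\Gamma)=\langle V(\Gamma)\mid [a,b]=1 \text{ for each } \{a,b\}\in E(\Gamma)\rangle$. The extension graph $\Gamma^e$ has vertex set $\{v^g : v\in V(\Gamma), g\in A(\Gamma)\}$, $v^g=g^{-1}vg$, with two distinct vertices adjacent iff they commute in $A(\Gamma)$. For a group $G$, let $T$ be the set of maximal cyclic subgroups of $G$ which have nonabelian centralizers in $G$. The abstract extension graph $G^e$ is the commutation graph of $T$: its vertex set is $T$, and two distinct cyclic subgroups are adjacent iff their generators commute. *)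

(* Defs.v *)
From HB Require Import structures.
From mathcomp Require Import all_boot.
From mathcomp Require Import boolp classical_sets functions cardinality.

Set Implicit Arguments.
Unset Strict Implicit.
Unset Printing Implicit Defensive.

Local Open Scope quotient_scope.
Local Open Scope classical_set_scope.
Local Open Scope group_scope.

(** Graphs are given by their adjacency relation, as in [fingraph]; simplicial
    means that this relation is symmetric and irreflexive. *)

Definition graph_iso (V W : Type) (E : rel V) (F : rel W) : Prop :=
  exists f : V -> W, bijective f /\ {mono f : x y / E x y >-> F x y}.

Definition has_induced (V W : Type) (E : rel V) (F : rel W) : Prop :=
  exists f : W -> V, injective f /\ {mono f : i j / F i j >-> E i j}.

Definition cycle_graph (n : nat) : rel 'I_n :=
  fun i j => (j == i.+1 %% n :> nat) || (i == j.+1 %% n :> nat).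

Definition triangle_free (V : Type) (E : rel V) : Prop :=
  ~ has_induced E (@cycle_graph 3).

Definition square_free (V : Type) (E : rel V) : Prop :=
  ~ has_induced E (@cycle_graph 4).

Definition connected (V : finType) (E : rel V) : Prop :=
  forall x y : V, connect E x y.

Definition degree (V : finType) (E : rel V) (x : V) : nat := #|[pred y | E x y]|.

(** Group presentations: a letter [(x, b)] is the generator [x] if [b] is [false]
    and its inverse if [b] is [true]. *)
Section Presentation.
Variables (X : choiceType) (R : set (seq (X * bool))).

Inductive word_eq : seq (X * bool) -> seq (X * bool) -> Prop :=
| word_eq_refl w : word_eq w w
| word_eq_sym w w' : word_eq w w' -> word_eq w' w
| word_eq_trans w1 w2 w3 : word_eq w1 w2 -> word_eq w2 w3 -> word_eq w1 w3
| word_eq_cat u u' w w' :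
    word_eq u u' -> word_eq w w' -> word_eq (u ++ w) (u' ++ w')
| word_eq_cancel x b : word_eq [:: (x, b); (x, ~~ b)] [::]
| word_eq_relator r : R r -> word_eq r [::].

Definition word_eqb : rel (seq (X * bool)) := fun u w => `[< word_eq u w >].

Lemma word_eqb_refl : reflexive word_eqb.
Proof. by move=> w; apply/asboolP/word_eq_refl. Qed.

Lemma word_eqb_sym : symmetric word_eqb.
Proof. by move=> u w; apply/asboolP/asboolP => /word_eq_sym. Qed.

Lemma word_eqb_trans : transitive word_eqb.
Proof.
move=> w u v /asboolP uw /asboolP wv.
by apply/asboolP/(word_eq_trans uw wv).
Qed.

Canonical word_equiv := EquivRel word_eqb word_eqb_refl word_eqb_sym word_eqb_trans.

Definition presented := {eq_quot word_equiv}.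
HB.instance Definition _ := Choice.on presented.
HB.instance Definition _ := EqQuotient.on presented.

Lemma presented_eqP u w : \pi_presented u = \pi_presented w <-> word_eq u w.
Proof.
by split=> [/eqmodP/asboolP | uw] //; apply/eqmodP/asboolP.
Qed.

Definition inv_word (w : seq (X * bool)) := rev [seq (l.1, ~~ l.2) | l <- w].

Lemma inv_wordK : involutive inv_word.
Proof.
move=> w; rewrite /inv_word map_rev revK -map_comp -[RHS]map_id.
by apply: eq_map => -[x b] /=; rewrite negbK.
Qed.

Lemma word_eq_mulV w : word_eq (w ++ inv_word w) [::].
Proof.
elim: w => [|[x b] w IHw]; first exact: word_eq_refl.
have -> : ((x, b) :: w) ++ inv_word ((x, b) :: w) =
    [:: (x, b)] ++ (w ++ inv_word w) ++ [:: (x, ~~ b)].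
  by rewrite /inv_word /= rev_cons -cats1 -catA.
apply: word_eq_trans (word_eq_cancel x b).
rewrite -[[:: (x, b); (x, ~~ b)]]/([:: (x, b)] ++ [::] ++ [:: (x, ~~ b)]).
apply: word_eq_cat; first exact: word_eq_refl.
by apply: word_eq_cat => //; apply: word_eq_refl.
Qed.

Lemma word_eq_mulVw w : word_eq (inv_word w ++ w) [::].
Proof. by rewrite -{2}[w]inv_wordK; apply: word_eq_mulV. Qed.

Lemma word_eq_inv u w : word_eq u w -> word_eq (inv_word u) (inv_word w).
Proof.
move=> uw; rewrite -[inv_word u]cats0.
apply: (@word_eq_trans _ (inv_word u ++ (w ++ inv_word w))).
  apply: word_eq_cat; first exact: word_eq_refl.
  exact/word_eq_sym/word_eq_mulV.
rewrite catA -[X in word_eq _ X]cat0s.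
apply: word_eq_cat; last exact: word_eq_refl.
apply: word_eq_trans (word_eq_mulVw u).
apply: word_eq_cat; first exact: word_eq_refl.
exact: word_eq_sym.
Qed.

Definition presented_one : presented := \pi_presented [::].
Definition presented_mul (g h : presented) : presented := \pi_presented (repr g ++ repr h).
Definition presented_inv (g : presented) : presented := \pi_presented (inv_word (repr g)).

Lemma word_eq_repr w : word_eq (repr (\pi_presented w)) w.
Proof. by apply/presented_eqP; rewrite reprK. Qed.

Lemma presented_mulE u w :
  presented_mul (\pi u) (\pi w) = \pi_presented (u ++ w).
Proof. by apply/presented_eqP/word_eq_cat; apply: word_eq_repr. Qed.

Lemma presented_invE w : presented_inv (\pi w) = \pi_presented (inv_word w).
Proof. exact/presented_eqP/word_eq_inv/word_eq_repr. Qed.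

Lemma presented_mulA : associative presented_mul.
Proof.
move=> g h k; rewrite -[g]reprK -[h]reprK -[k]reprK.
by rewrite !presented_mulE catA.
Qed.

Lemma presented_mul1 : left_id presented_one presented_mul.
Proof. by move=> g; rewrite -[g]reprK presented_mulE. Qed.

Lemma presented_mulr1 : right_id presented_one presented_mul.
Proof. by move=> g; rewrite -[g]reprK presented_mulE cats0. Qed.

Lemma presented_mulV : left_inverse presented_one presented_inv presented_mul.
Proof.
move=> g; rewrite -[g]reprK presented_invE presented_mulE.
exact/presented_eqP/word_eq_mulVw.
Qed.

Lemma presented_mulrV : right_inverse presented_one presented_inv presented_mul.
Proof.
move=> g; rewrite -[g]reprK presented_invE presented_mulE.
exact/presented_eqP/word_eq_mulV.
Qed.

HB.instance Definition _ := isGroup.Build presented presented_mulA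
  presented_mul1 presented_mulr1 presented_mulV presented_mulrV.

Definition generator (x : X) : presented := \pi_presented [:: (x, false)].

End Presentation.

Section RightAngledArtinGroup.
Variables (V : choiceType) (E : rel V).

Definition raag_relators : set (seq (V * bool)) :=
  [set r | exists a b, E a b /\
     r = [:: (a, true); (b, true); (a, false); (b, false)]].

Definition raag : groupType := presented raag_relators.

Definition raag_gen (v : V) : raag := generator raag_relators v.

Definition ext_vertices : set raag := [set x | exists v g, x = raag_gen v ^ g].

Definition ext_graph : rel ext_vertices :=
  fun x y => (x != y) && `[< commute (val x) (val y) >].

End RightAngledArtinGroup.

Section AbstractExtensionGraph.
Variable G : groupType.
Implicit Types (x y : G) (C D : set G).

Definition cyclic_subgroup x : set G :=
  [set y | exists n : nat, y = x ^+ n \/ y = x ^- n].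

Definition is_cyclic C : Prop := exists x, C = cyclic_subgroup x.

Definition is_maximal_cyclic C : Prop :=
  is_cyclic C /\ forall D, is_cyclic D -> C `<=` D -> D = C.

Definition centralizer C : set G := [set x | forall y, C y -> commute x y].

Definition is_abelian C : Prop := forall x y, C x -> C y -> commute x y.

Definition abs_ext_vertices : set (set G) :=
  [set C | is_maximal_cyclic C /\ ~ is_abelian (centralizer C)].

Definition abs_ext_graph : rel abs_ext_vertices :=
  fun P Q => (P != Q) &&
    `[< forall x y, val P = cyclic_subgroup x -> val Q = cyclic_subgroup y ->
        commute x y >].

End AbstractExtensionGraph.

(** A [groupClosed] predicate is a subgroup; [subgroup_type] is the subgroup
    regarded as a group in its own right. *)
Section Subgroup.
Variables (gT : groupType) (S : groupClosed gT).

Definition subgroup_type := {x : gT | x \in S}.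
HB.instance Definition _ := SubChoice.on subgroup_type.

Lemma subgroup_closed : group_closed S.
Proof. by split=> [|x y xS yS]; [exact: gpred1 | exact: gpredF]. Qed.

HB.instance Definition _ :=
  SubChoice_isSubGroup.Build gT _ subgroup_type subgroup_closed.

Definition finite_index : Prop :=
  finite_set (range (fun g : gT => [set g * h | h in [set` S]])).

End Subgroup.

(* Main.v *)
Require Import Defs.
From mathcomp Require Import all_boot.
From mathcomp Require Import boolp classical_sets cardinality.
From mathcomp Require Import ssralg ssrnum ssrint.
From mathcomp Require Import zify.

Set Implicit Arguments.
Unset Strict Implicit.
Unset Printing Implicit Defensive.

(** Write A for the right-angled Artin group of the graph. The isomorphism matches
    a vertex p of the extension graph, a conjugate of a generator v, with the
    cyclic subgroup of G formed by the powers of p that lie in G. It is generated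
    by a positive power of p because G has finite index. Three facts about A make
    this work.

    Roots: if a positive power of g commutes with h, then so does g
    ([commute_root]), and A is torsion-free ([expg_eq1]). With exponent sums, which
    say which power of p an element has to be, a root of a power of p is itself a
    power of p ([root_in_cyclic]). Hence the powers of p in G form a maximal cyclic
    subgroup of G, distinct p have distinct subgroups, and generators of two such
    subgroups commute exactly if the vertices do.

    The centralizer of p is large: v has two neighbours, which are not adjacent to
    each other because there are no triangles, so their conjugates, and by the root
    property any positive powers of these, do not commute. They commute with p, so
    the centralizer in G of the powers of p is nonabelian.

    Other centralizers are abelian ([nonabelian_centralizer]): up to conjugation an
    element g is given by a cyclically reduced word w, and if w involves two
    different vertices then the absence of triangles and squares leaves only two
    shapes for the support of w together with its link. Either the complement of
    the graph is connected on the support and the link has at most one vertex, or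
    the support is a star and the link is empty. In both cases every element of
    the centralizer has a power that is a power of w up to a central factor, and
    the root property makes the centralizer abelian.

    The tool for roots and centralizers is the solution of the word problem
    ([reduced_element]): two reduced words for one element have the same
    projections to every pair of nonadjacent vertices. If y commutes with a
    cyclically reduced w, some y w^k has a reduced word z such that zw and wz are
    both reduced ([commute_trace]); the projections of z and w then commute in a
    free monoid, where commuting words have a common power. *)

(** * Powers and commutation in free monoids *)

Section WordPowers.

Lemma filter_rem (T : eqType) (p : pred T) x (s : seq T) :
  filter p (rem x s) = if p x then rem x (filter p s) else filter p s.
Proof.
elim: s => [|y s IHs] /=; first by case: ifP.
have [->|yx] := eqVneq y x; first by case: (p x) => //=; rewrite eqxx.
rewrite /= IHs; case: (p x) => //; case: (p y) => //=.
by rewrite (negPf yx).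
Qed.

Definition wpow (T : Type) (s : seq T) n := iter n (cat s) [::].

Lemma wpowS (T : Type) (s : seq T) n : wpow s n.+1 = s ++ wpow s n.
Proof. by []. Qed.

Lemma wpowD (T : Type) (s : seq T) m n : wpow s (m + n) = wpow s m ++ wpow s n.
Proof. by elim: m => // m IHm; rewrite addSn !wpowS IHm catA. Qed.

Lemma wpowM (T : Type) (s : seq T) m n : wpow s (m * n) = wpow (wpow s n) m.
Proof. by elim: m => //= m IHm; rewrite mulSn wpowD IHm. Qed.

Lemma size_wpow (T : Type) (s : seq T) n : size (wpow s n) = (n * size s)%N.
Proof. by elim: n => //= n IHn; rewrite size_cat IHn mulSn. Qed.

Lemma filter_wpow (T : Type) (p : pred T) (s : seq T) n :
  filter p (wpow s n) = wpow (filter p s) n.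
Proof. by elim: n => //= n IHn; rewrite filter_cat IHn. Qed.

Lemma count_wpow (T : Type) (p : pred T) (s : seq T) n :
  count p (wpow s n) = (n * count p s)%N.
Proof. by rewrite -!size_filter filter_wpow size_wpow. Qed.

Lemma wpow_comm (T : Type) (s t : seq T) m n :
  s ++ t = t ++ s -> wpow s m ++ wpow t n = wpow t n ++ wpow s m.
Proof.
move=> st.
have comm1 k : s ++ wpow t k = wpow t k ++ s.
  by elim: k => [|k IHk]; rewrite ?cats0 // wpowS -catA -IHk !catA st.
elim: m => [|m IHm]; first by rewrite cats0.
by rewrite wpowS -catA IHm !catA comm1.
Qed.

(** [wpow s m ++ wpow t n] can be read in either order, and words of equal length
    at the start of the same word coincide. *)
Lemma wpow_eq (T : eqType) (s t : seq T) m n :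
  s ++ t = t ++ s -> (m * size s = n * size t)%N -> wpow s m = wpow t n.
Proof.
move=> st mn; move/eqP: (wpow_comm m n st).
by rewrite eqseq_cat ?size_wpow // => /andP[/eqP].
Qed.

Lemma wpow_comm_root (T : eqType) (s t : seq T) n :
  0 < n -> wpow s n ++ t = t ++ wpow s n -> s ++ t = t ++ s.
Proof.
move=> n0 snt; have [s0|s0] := posnP (size s).
  by rewrite (size0nil s0) cats0.
have [t0|t0] := posnP (size t); first by rewrite (size0nil t0) cats0.
(* [s] and [t] have a common power, so both are prefixes of its square, and so
   are [s ++ t] and [t ++ s]. *)
have st : wpow s (size t * n) = wpow t (size s * n).
  have := wpow_eq (m := size t) (n := (n * size s)%N) snt.
  rewrite size_wpow mulnC => /(_ erefl).
  by rewrite -wpowM [(n * size s)%N]mulnC.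
have [i iE] : exists i, (size t * n = i.+1)%N.
  by exists (size t * n).-1; rewrite prednK // muln_gt0 t0.
have [j jE] : exists j, (size s * n = j.+1)%N.
  by exists (size s * n).-1; rewrite prednK // muln_gt0 s0.
rewrite iE jE in st.
have : s ++ t ++ (wpow t j ++ wpow s i) = t ++ s ++ (wpow s i ++ wpow t j).
  have -> : s ++ t ++ (wpow t j ++ wpow s i) = wpow s (i.+1 + i.+1).
    by rewrite [t ++ _]catA -wpowS -st -wpowD -wpowS addnS.
  have -> : t ++ s ++ (wpow s i ++ wpow t j) = wpow t (j.+1 + j.+1).
    by rewrite [s ++ _]catA -wpowS st -wpowD -wpowS addnS.
  by rewrite !wpowD st.
rewrite [LHS]catA [RHS]catA => /eqP.
by rewrite eqseq_cat ?size_cat 1?addnC // => /andP[/eqP].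
Qed.

End WordPowers.

(** * Cyclic subgroups and finite index *)

Section CyclicSubgroups.
Local Open Scope group_scope.
Variable G : groupType.
Implicit Types x y z : G.

Lemma commute_conjg x y z :
  commute (x ^ z) (y ^ z) <-> commute x y.
Proof.
split=> xy; last by rewrite /commute -!conjMg xy.
by apply: (@conjg_inj _ z); rewrite !conjMg.
Qed.

Lemma cyclic_subgroup_id x : cyclic_subgroup x x.
Proof. by exists 1%N; left. Qed.

Lemma cyclic_subgroupX x n : cyclic_subgroup x (x ^+ n).
Proof. by exists n; left. Qed.

Lemma cyclic_subgroupV x y : cyclic_subgroup x y -> cyclic_subgroup x y^-1.
Proof. by case=> n [] ->; exists n; [right | left; rewrite invgK]. Qed.

Lemma cyclic_subgroup_trans x y z :
  cyclic_subgroup x y -> cyclic_subgroup y z -> cyclic_subgroup x z.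
Proof.
move=> xy [m yz]; suff xym : cyclic_subgroup x (y ^+ m).
  by case: yz => ->; last exact: cyclic_subgroupV.
case: xy => n [] ->; first by rewrite -expgnA; apply: cyclic_subgroupX.
by rewrite -expVgn -expgnA expVgn; apply/cyclic_subgroupV/cyclic_subgroupX.
Qed.

Lemma cyclic_subgroup_eq x y :
  cyclic_subgroup x y -> cyclic_subgroup y x -> cyclic_subgroup x = cyclic_subgroup y.
Proof. by move=> xy yx; apply/seteqP; split=> z; apply: cyclic_subgroup_trans. Qed.

Lemma commute_cyclic_subgroup x y z :
  commute z x -> cyclic_subgroup x y -> commute z y.
Proof. by move=> zx [n [] ->]; [|apply: commuteV]; apply: commuteX. Qed.

Lemma centralizer_cyclic x :
  centralizer (cyclic_subgroup x) = [set z | commute z x]%classic.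
Proof.
apply/seteqP; split=> z; first by apply; apply: cyclic_subgroup_id.
by move=> zx y; apply: commute_cyclic_subgroup.
Qed.

End CyclicSubgroups.

Section FiniteIndex.
Local Open Scope group_scope.
Variables (gT : groupType) (G : groupClosed gT).

(** Two different powers of [g] lie in the same coset. *)
Lemma expg_in_finite_index (g : gT) :
  finite_index G -> exists2 n, 0 < n & g ^+ n \in G.
Proof.
pose coset i := [set g ^+ i * h | h in [set` G]]%classic => finG.
have [i [j [ij cij]]] : exists i j, i < j /\ coset i = coset j.
  apply: contrapT => no_coll; apply: infinite_nat.
  have <- : (coset @^-1` range (fun h => [set h * k | k in [set` G]]))%classic = setT.
    by apply/seteqP; split=> // i _; exists (g ^+ i).
  apply: finite_preimage finG => i j _ _ cij.
  apply/eqP; apply: contraT; rewrite neq_ltn => /orP[] ij; case: no_coll.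
    by exists i, j.
  by exists j, i.
exists (j - i); first by rewrite subn_gt0.
have [h Gh hE] : coset i (g ^+ j).
  by rewrite cij; exists 1; rewrite ?mulg1 //=; apply: gpred1.
have -> // : g ^+ (j - i) = h.
apply: (@mulgI _ (g ^+ i)); rewrite hE -expgnDr subnKC //; exact: ltnW.
Qed.

End FiniteIndex.

(** * Traces and reduced words *)

Section Raag.
Variables (V : finType) (E : rel V).
Hypotheses (symE : symmetric E) (irrE : irreflexive E).
Implicit Types (l c : V * bool) (u w s : seq (V * bool)) (a b : V).

Definition inv_letter l := (l.1, ~~ l.2).

Lemma inv_letterK : involutive inv_letter.
Proof. by case=> a t; rewrite /inv_letter /= negbK. Qed.

Lemma inv_letter_neq l : (inv_letter l == l) = false.
Proof. by case: l => a []; rewrite /inv_letter xpair_eqE eqxx. Qed.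

Definition proj a b w := [seq l <- w | (l.1 == a) || (l.1 == b)].

(** The projection criterion for two words to differ only by exchanges of
    neighbouring letters at adjacent vertices. The pairs with [a = b] fix the order
    of the letters at a single vertex. *)
Definition trace_eq u w := forall a b, ~~ E a b -> proj a b u = proj a b w.

Lemma trace_eq_sym u w : trace_eq u w -> trace_eq w u.
Proof. by move=> uw a b ab; rewrite uw. Qed.

Lemma trace_eq_trans s u w : trace_eq u s -> trace_eq s w -> trace_eq u w.
Proof. by move=> us sw a b ab; rewrite us // sw. Qed.

Lemma proj_cat a b u w : proj a b (u ++ w) = proj a b u ++ proj a b w.
Proof. exact: filter_cat. Qed.

Lemma proj_rem a b l w :
  proj a b (rem l w) =
    if (l.1 == a) || (l.1 == b) then rem l (proj a b w) else proj a b w.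
Proof. exact: filter_rem. Qed.

Lemma adjacent_notin_pair x y a b :
  E x y -> ~~ E a b -> (x == a) || (x == b) -> (y == a) || (y == b) = false.
Proof.
move=> xy ab xab; apply: contraNF ab => yab; move: xy.
by case/orP: xab yab => /eqP-> /orP[] /eqP->; rewrite ?irrE // symE.
Qed.

(** The letter [l] can be shuffled to the front of [w]. *)
Fixpoint front l w :=
  if w is c :: w' then (c == l) || E l.1 c.1 && front l w' else false.

(** Only a letter at a vertex not adjacent to that of [l] can block [l], and the
    projection to these two vertices shows it. So [front] depends on projections
    only. *)
Lemma frontP l w :
  reflect (forall b, ~~ E l.1 b -> ohead (proj l.1 b w) = Some l) (front l w).
Proof.
apply: (iffP idP) => [|].
  elim: w => //= c w IHw /orP[/eqP -> b _ | /andP[lc lw] b lb] /=.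
    by rewrite eqxx.
  have /negPf-> : c.1 != l.1 by apply: contraTneq lc => ->; rewrite irrE.
  have /negPf-> /= : c.1 != b by apply: contraTneq lc => ->.
  exact: IHw.
elim: w => [/(_ l.1)|c w IHw H] /=; first by rewrite irrE => /(_ isT).
have [//|cl] := eqVneq c l; have [lc|lc] /= := boolP (E l.1 c.1).
  apply: IHw => b lb; rewrite -(H b lb) /=.
  have /negPf-> : c.1 != l.1 by apply: contraTneq lc => ->; rewrite irrE.
  by have /negPf-> : c.1 != b by apply: contraTneq lc => ->.
by move: (H c.1 lc); rewrite /= eqxx orbT /= => -[/eqP]; rewrite (negPf cl).
Qed.

Lemma front_trace_eq l u w : trace_eq u w -> front l u = front l w.
Proof.
move=> uw; apply/frontP/frontP => H b lb; first by rewrite -uw ?H.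
by rewrite uw ?H.
Qed.

Lemma mem_front l w : front l w -> l \in w.
Proof.
elim: w => //= c w IHw /orP[/eqP->|/andP[_ /IHw lw]]; first exact: mem_head.
by rewrite in_cons lw orbT.
Qed.

Lemma front_cat l u w :
  front l (u ++ w) = front l u || all (fun c => E l.1 c.1) u && front l w.
Proof.
elim: u => //= c u ->; case: (c == l) => //=.
by rewrite andb_orr andbA.
Qed.

Lemma trace_eq_cons_rem l w : front l w -> trace_eq w (l :: rem l w).
Proof.
elim: w => //= c w IHw; have [-> _ //|cl /= /andP[lc lw]] := eqVneq c l.
move=> a b ab; have := IHw lw a b ab; rewrite /=.
case: ifP => lab; last by case: ifP => _ ->.
by rewrite (adjacent_notin_pair lc ab lab).
Qed.

Lemma trace_eq_rem l u w : trace_eq u w -> trace_eq (rem l u) (rem l w).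
Proof. by move=> uw a b ab; rewrite !proj_rem uw. Qed.

Lemma size_trace_eq u w : trace_eq u w -> size u = size w.
Proof.
elim: u w => [|l u IHu] w uw.
  case: w uw => // c w /(_ c.1 c.1); rewrite irrE => /(_ isT).
  by rewrite /= eqxx.
have lw : front l w by rewrite -(front_trace_eq _ uw) /= eqxx.
rewrite (perm_size (perm_to_rem (mem_front lw))) /=; congr _.+1; apply: IHu.
by have := trace_eq_rem l uw; rewrite /= eqxx.
Qed.

Lemma front_adjacent_cons l c w :
  E l.1 c.1 -> front l (c :: w) = front l w.
Proof.
move=> lc /=; rewrite lc; case: eqP => // cl.
by move: lc; rewrite cl irrE.
Qed.

Lemma front_adjacent_rem l c w :
  E l.1 c.1 -> front l (rem c w) = front l w.
Proof.
move=> lc; elim: w => //= d w IHw; have [->|dc] := eqVneq d c.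
  exact/esym/front_adjacent_cons.
by rewrite /= IHw.
Qed.

(** No letter can be shuffled next to an inverse letter. *)
Fixpoint reduced w :=
  if w is c :: w' then ~~ front (inv_letter c) w' && reduced w' else true.

Lemma reduced_rem l w : front l w -> reduced w -> reduced (rem l w).
Proof.
elim: w => //= c w IHw; have [-> _ /andP[]//|cl /=] := eqVneq c l.
case/andP=> lc lw /andP[cw rw]; rewrite front_adjacent_rem 1?symE //.
by rewrite cw IHw.
Qed.

(** Otherwise the letter and its inverse would cancel within [w]. *)
Lemma front_inv_rem l w :
  front l w -> reduced w -> ~~ front (inv_letter l) (rem l w).
Proof.
elim: w => //= c w IHw; have [-> _ /andP[]//|cl /=] := eqVneq c l.
case/andP=> lc lw /andP[cw rw]; rewrite negb_or lc IHw // andbT.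
by apply: contraTneq lc => ->; rewrite irrE.
Qed.

(** A cancellation in [u ++ w] takes place between a letter that can be shuffled to
    the end of [u] and its inverse at the front of [w]. *)
Lemma reduced_cat_cancel u w :
  reduced u -> reduced w -> ~~ reduced (u ++ w) ->
  exists l u1 u2, [/\ u = u1 ++ l :: u2, all (fun c => E l.1 c.1) u2
                    & front (inv_letter l) w].
Proof.
elim: u => [_ ->//|c u IHu] /= /andP[cu ru] rw.
have [ruw|nruw _] := boolP (reduced (u ++ w)); last first.
  have [l [u1 [u2 [-> lu2 lw]]]] := IHu ru rw nruw.
  by exists l, (c :: u1), u2.
rewrite andbT negbK front_cat (negPf cu) /= => /andP[cu' cw].
by exists c, [::], u.
Qed.

(** * The action on reduced words, and the word problem *)

(** Left multiplication by a letter, with the cancellation carried out. On reduced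
    words up to [trace_eq] this is an action of the group. *)
Definition act l w :=
  if front (inv_letter l) w then rem (inv_letter l) w else l :: w.

Definition acts u w := foldr act w u.

Lemma reduced_act l w : reduced w -> reduced (act l w).
Proof.
rewrite /act => rw; case: ifP => lw; first exact: reduced_rem.
by rewrite /= lw.
Qed.

Lemma reduced_acts u w : reduced w -> reduced (acts u w).
Proof. by move=> rw; elim: u => //= l u; apply: reduced_act. Qed.

Lemma acts_nil w : reduced w -> acts w [::] = w.
Proof. by elim: w => //= l w IHw /andP[lw /IHw->]; rewrite /act (negPf lw). Qed.

Lemma leq_size_act l w : size (act l w) <= (size w).+1.
Proof.
rewrite /act; case: ifP => //= lw; rewrite size_rem ?mem_front //.
exact: leq_trans (leq_pred _) _.
Qed.

Lemma trace_eq_act l u w : trace_eq u w -> trace_eq (act l u) (act l w).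
Proof.
move=> uw; rewrite /act (front_trace_eq _ uw); case: ifP => _.
  exact: trace_eq_rem.
by move=> a b ab /=; rewrite uw.
Qed.

Lemma trace_eq_acts s u w : trace_eq u w -> trace_eq (acts s u) (acts s w).
Proof. by move=> uw; elim: s => //= l s; apply: trace_eq_act. Qed.

Lemma act_invK l w : reduced w -> trace_eq (act l (act (inv_letter l) w)) w.
Proof.
rewrite {2}/act inv_letterK => rw; case: ifP => lw.
  rewrite /act (negPf (front_inv_rem lw rw)).
  by apply: trace_eq_sym; apply: trace_eq_cons_rem.
by rewrite /act /= eqxx.
Qed.

Lemma front_act_adjacent l c w : E l.1 c.1 -> front l (act c w) = front l w.
Proof.
move=> lc; rewrite /act; case: ifP => _; first exact: front_adjacent_rem.
exact: front_adjacent_cons.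
Qed.

Lemma proj_act_adjacent a b l w : ~~ ((l.1 == a) || (l.1 == b)) ->
  proj a b (act l w) = proj a b w.
Proof.
by move=> /negPf lab; rewrite /act; case: ifP => _; rewrite ?proj_rem /= lab.
Qed.

Lemma proj_act a b l w : (l.1 == a) || (l.1 == b) ->
  proj a b (act l w) =
    if front (inv_letter l) w then rem (inv_letter l) (proj a b w)
    else l :: proj a b w.
Proof.
by move=> lab; rewrite /act; case: ifP => _; rewrite ?proj_rem /= lab.
Qed.

(** Letters at adjacent vertices never occur in a common projection, so neither
    action sees the effect of the other. *)
Lemma act_adjacentC l c w :
  E l.1 c.1 -> trace_eq (act l (act c w)) (act c (act l w)).
Proof.
move=> lc a b ab; have cl : E c.1 l.1 by rewrite symE.
case lab: ((l.1 == a) || (l.1 == b)).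
  have cab := adjacent_notin_pair lc ab lab.
  rewrite (@proj_act_adjacent a b c) ?cab // !(@proj_act a b l) //.
  by rewrite front_act_adjacent // proj_act_adjacent ?cab.
rewrite (@proj_act_adjacent a b l) ?lab //.
case cab: ((c.1 == a) || (c.1 == b)); last first.
  by rewrite !proj_act_adjacent ?lab ?cab.
rewrite !(@proj_act a b c) // front_act_adjacent //.
by rewrite proj_act_adjacent ?lab.
Qed.

Local Notation word_eq := (word_eq (@raag_relators V E)).

(** The defining relators and the cancellations act trivially on reduced words
    up to [trace_eq], hence equal elements act in the same way. *)
Lemma word_eq_acts u w s :
  word_eq u w -> reduced s -> trace_eq (acts u s) (acts w s).
Proof.
move=> uw; elim: uw s => {u w}
  [w|u w _ IH|u v w _ IHu _ IHw|u u' w w' _ IHu _ IHw|x b|r].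
- by [].
- by move=> s rs; apply/trace_eq_sym/IH.
- by move=> s rs; apply: trace_eq_trans (IHu _ rs) (IHw _ rs).
- move=> s rs; rewrite /acts !foldr_cat.
  apply: trace_eq_trans (trace_eq_acts _ (IHw s rs)) _.
  exact/IHu/reduced_acts.
- by move=> s; apply: act_invK.
- case=> a [b [ab ->]] s rs /=.
  apply: trace_eq_trans (act_invK (a, true) rs).
  apply: trace_eq_trans (trace_eq_act _ (act_invK (b, true) _)); last first.
    exact: reduced_act.
  do 2 apply: trace_eq_act.
  exact: act_adjacentC.
Qed.

Local Open Scope group_scope.

Definition element w : raag E := \pi_(presented (@raag_relators V E))%qT w.

Lemma elementP g : exists w, g = element w.
Proof. by exists (repr g); rewrite /element reprK. Qed.

Lemma element_eq u w : element u = element w <-> word_eq u w.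
Proof. exact: presented_eqP. Qed.

Lemma element_cat u w : element (u ++ w) = element u * element w.
Proof. exact/esym/presented_mulE. Qed.

Lemma element_cons l w : element (l :: w) = element [:: l] * element w.
Proof. by rewrite -element_cat. Qed.

Lemma element_inv w : element (inv_word w) = (element w)^-1.
Proof. exact/esym/presented_invE. Qed.

Lemma element_inv_letter l : element [:: inv_letter l] = (element [:: l])^-1.
Proof. by rewrite -element_inv. Qed.

Lemma element_wpow w n : element (wpow w n) = element w ^+ n.
Proof. by elim: n => //= n IHn; rewrite element_cat IHn expgS. Qed.

Lemma commute_letters l c :
  E l.1 c.1 -> commute (element [:: l]) (element [:: c]).
Proof.
have gens a b : E a b ->
    commute (element [:: (a, false)]) (element [:: (b, false)]).
  move=> ab.
  have : element [:: (a, true); (b, true); (a, false); (b, false)] = 1.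
    by apply/element_eq/word_eq_relator; exists a, b.
  rewrite !(element_cons _ (_ :: _)) -/(inv_letter (a, false)).
  rewrite -/(inv_letter (b, false)) !element_inv_letter.
  move/mulg1_eq; rewrite invgK /commute => {2}->.
  by rewrite mulVKg.
case: l c => a [] [b []] /= ab; have := gens a b ab => // comm.
- rewrite -/(inv_letter (a, false)) -/(inv_letter (b, false)) !element_inv_letter.
  exact/commuteV/commute_sym/commuteV/commute_sym.
- rewrite -/(inv_letter (a, false)) element_inv_letter.
  exact/commute_sym/commuteV/commute_sym.
- rewrite -/(inv_letter (b, false)) element_inv_letter.
  exact/commuteV.
Qed.

Lemma commute_same_vertex l c :
  l.1 = c.1 -> commute (element [:: l]) (element [:: c]).
Proof.
case: l c => a s [_ t] /= <-.
have [->|] := eqVneq t s; first exact: commute_refl.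
rewrite -addbT => ts; have -> : (a, t) = inv_letter (a, s).
  by case: s t ts => [] [].
by rewrite element_inv_letter; apply: commuteV; apply: commute_refl.
Qed.

Lemma commute_word g w :
  {in w, forall l, commute g (element [:: l])} -> commute g (element w).
Proof.
elim: w => [_|l w IHw H]; first exact: commute1.
rewrite element_cons; apply: commuteM; first exact/H/mem_head.
by apply: IHw => c cw; apply: H; rewrite in_cons cw orbT.
Qed.

Lemma element_rem l w : front l w -> element w = element (l :: rem l w).
Proof.
elim: w => //= c w IHw; have [-> //|cl /= /andP[lc lw]] := eqVneq c l.
rewrite element_cons (IHw lw) (element_cons l (rem l w)).
rewrite (element_cons l (c :: _)) (element_cons c (rem l w)) !mulgA.
by congr (_ * _); apply: commute_letters; rewrite symE.
Qed.

(** The first letter of [u] can be shuffled to the front of [w]; remove it from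
    both and repeat. *)
Lemma trace_eq_element u w : trace_eq u w -> element u = element w.
Proof.
elim: u w => [|l u IHu] w uw.
  case: w uw => // c w /(_ c.1 c.1); rewrite irrE => /(_ isT).
  by rewrite /= eqxx.
have lw : front l w by rewrite -(front_trace_eq _ uw) /= eqxx.
rewrite (element_rem lw) (element_cons l u) (element_cons l (rem l w)).
congr (_ * _); apply: IHu.
have := trace_eq_rem l (trace_eq_trans uw (trace_eq_cons_rem lw)).
by rewrite /= eqxx.
Qed.

Lemma element_act l w : element (act l w) = element (l :: w).
Proof.
rewrite /act; case: ifP => // lw.
by rewrite element_cons (element_rem lw) (element_cons (inv_letter l) (rem _ _))
  element_inv_letter mulVKg.
Qed.

Definition normal_form w := acts w [::].

Lemma element_normal_form w : element (normal_form w) = element w.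
Proof.
elim: w => //= l w IHw.
by rewrite element_act element_cons IHw -element_cons.
Qed.

Lemma reduced_normal_form w : reduced (normal_form w).
Proof. exact: reduced_acts. Qed.

Lemma size_normal_form w : size (normal_form w) <= size w.
Proof.
by elim: w => //= l w IHw; apply: leq_trans (leq_size_act _ _) _.
Qed.

Lemma size_normal_form_eq w : size w <= size (normal_form w) -> reduced w.
Proof.
elim: w => //= l w IHw; case: (ltnP (size (normal_form w)) (size w)) => [sw|].
  by move/leq_trans/(_ (leq_size_act _ _)); rewrite ltnS leqNgt sw.
move/IHw => rw; rewrite rw /normal_form acts_nil // /act; case: ifP => // lw.
by rewrite size_rem ?mem_front // => /leq_trans/(_ (leq_pred _)); rewrite ltnn.
Qed.

(** The action of the element on the empty word gives back any reduced word for
    it. *)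
Lemma reduced_element u w :
  reduced u -> reduced w -> element u = element w -> trace_eq u w.
Proof.
move=> ru rw /element_eq uw; rewrite -(acts_nil ru) -(acts_nil rw).
exact: word_eq_acts.
Qed.

Lemma size_reduced u w :
  reduced u -> element u = element w -> size u <= size w.
Proof.
move=> ru uw; apply: leq_trans (size_normal_form w).
rewrite (@size_trace_eq u (normal_form w)) //.
by apply: reduced_element; rewrite ?reduced_normal_form ?element_normal_form.
Qed.

Lemma reduced_geodesic u w :
  reduced u -> element u = element w -> size w <= size u -> reduced w.
Proof.
move=> ru uw wu; apply/size_normal_form_eq/(leq_trans wu)/size_reduced => //.
by rewrite element_normal_form.
Qed.

(** * Cyclically reduced words *)

(** Asking this of all powers makes the notion pass to powers of [w]. *)
Definition cyclically_reduced w := forall k, reduced (wpow w k).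

Lemma cyclically_reduced_wpow w n :
  cyclically_reduced w -> cyclically_reduced (wpow w n).
Proof. by move=> cw i; rewrite -wpowM; apply: cw. Qed.

(** [l] can be shuffled to the end of the word and its inverse to the front, so
    conjugation by [l] removes both. *)
Lemma cancel_ends_conj u1 l u2 :
  all (fun c => E l.1 c.1) u2 -> front (inv_letter l) (u1 ++ l :: u2) ->
  element (u1 ++ l :: u2) =
    element (rem (inv_letter l) u1 ++ u2) ^ element [:: l].
Proof.
move=> lu2; rewrite front_cat /= eq_sym inv_letter_neq irrE /= andbF orbF => lu1.
rewrite !element_cat (element_rem lu1) element_cons element_inv_letter.
rewrite (element_cons l u2) /conjg -!mulgA; do 2 congr (_ * _).
by apply: commute_word => c /(allP lu2) lc; apply: commute_letters.
Qed.

Lemma conj_cyclically_reduced g :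
  exists w h, cyclically_reduced w /\ g = element w ^ h.
Proof.
have [w ->] := elementP g; have [n] := ubnP (size w).
elim: n w => // n IHn w wn.
pose u := normal_form w; rewrite -element_normal_form -/u.
have ru : reduced u by apply: reduced_normal_form.
have un : size u <= n by apply: leq_trans (size_normal_form w) wn.
(* Shorten the word by conjugation as long as its last letters cancel its
   first ones. *)
have [[l [u1 [u2 [uE lu2 lu]]]]|no_cancel] := pselect
    (exists l u1 u2, [/\ u = u1 ++ l :: u2, all (fun c => E l.1 c.1) u2
                    & front (inv_letter l) u]).
  rewrite uE in lu; rewrite uE cancel_ends_conj //.
  have [|v [h [cv ->]]] := IHn (rem (inv_letter l) u1 ++ u2).
    apply: leq_trans un; rewrite uE !size_cat /= addnS ltnS leq_add2r.
    by rewrite size_subseq ?rem_subseq.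
  by exists v, (h * element [:: l]); rewrite conjgM.
exists u, 1; rewrite conjg1; split => //; elim=> // k IHk; rewrite wpowS.
apply/negPn/negP => /(reduced_cat_cancel ru IHk)[l [u1 [u2 [uE lu2]]]].
(* A cancellation between copies of [u] stays within two consecutive copies,
   since a whole copy between them contains the letter [l] itself. *)
case: k IHk => // k _; rewrite wpowS front_cat => /orP[lu|/andP[+ _]].
  by apply: no_cancel; exists l, u1, u2.
by rewrite uE all_cat /= irrE andbF.
Qed.

(** * Commuting elements and roots *)

(** After multiplication by enough copies of [w] nothing cancels any more. Then
    [z ++ w] and [w ++ z] are reduced words for the same element, and a commutation
    in the group becomes one between traces. *)
Lemma commute_trace y w :
  cyclically_reduced w -> commute y (element w) ->
  exists k z, element z = y * element w ^+ k /\ trace_eq (z ++ w) (w ++ z).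
Proof.
move=> cw yw; have rw : reduced w by have := cw 1%N; rewrite /wpow /= cats0.
have [v vE] := elementP y.
suff [k [z [zE rz rzw]]] : exists k z,
    [/\ element z = y * element w ^+ k, reduced z & reduced (z ++ w)].
  exists k, z; split=> //.
  have eq_zw : element (z ++ w) = element (w ++ z).
    rewrite !element_cat zE; apply/commute_sym/commuteM; first exact: commute_sym.
    exact: commuteX.
  apply: reduced_element => //; apply: reduced_geodesic eq_zw _ => //.
  by rewrite !size_cat addnC.
apply: contrapT => no_k.
(* If [y * w ^+ n] never absorbs a further [w] without cancellation, each
   multiplication by [w] gains fewer than [size w] letters; but [w ^+ n] has
   length [n * size w], and [y] can only hide [size v] of it. *)
have loss n : exists z, [/\ element z = y * element w ^+ n, reduced z
    & size z + n <= size v + (n * size w)%N].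
  elim: n => [|n [z [zE rz zn]]].
    exists (normal_form v); rewrite element_normal_form mulg1 vE.
    split=> //; first exact: reduced_normal_form.
    by rewrite !addn0 size_normal_form.
  have zwE : element (normal_form (z ++ w)) = y * element w ^+ n.+1.
    by rewrite element_normal_form element_cat zE -mulgA -expgSr.
  exists (normal_form (z ++ w)); split=> //; first exact: reduced_normal_form.
  have : size (normal_form (z ++ w)) < size (z ++ w).
    rewrite ltnNge; apply/negP => /size_normal_form_eq rzw.
    by apply: no_k; exists n, z.
  rewrite size_cat; lia.
have [z [zE _ zn]] := loss (2 * size v)%N.+1.
have : ((2 * size v).+1 * size w <= size v + size z)%N.
  have sv : size (inv_word v) = size v by rewrite /inv_word size_rev size_map.
  rewrite -size_wpow -[in leqRHS]sv -size_cat.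
  apply: size_reduced; first exact: cw.
  by rewrite element_wpow element_cat element_inv zE vE mulKg.
move: zn; move: (_ * size w)%N => N; lia.
Qed.

(** Up to powers of [w], [h] is a trace whose projections commute with a power of
    the projections of [w], hence with these projections themselves. *)
Lemma commute_root (g h : raag E) n :
  0 < n -> commute (g ^+ n) h -> commute g h.
Proof.
move=> n0; have [w [k [cw ->]]] := conj_cyclically_reduced g.
rewrite -conjXg -(conjgKV k h) !commute_conjg; move: (h ^ _) => y yw.
have [||i [z [zE zw]]] := @commute_trace y (wpow w n).
- exact: cyclically_reduced_wpow.
- by rewrite element_wpow; apply: commute_sym.
have {zw} wz : trace_eq (w ++ z) (z ++ w).
  move=> a b ab; have := zw a b ab.
  by rewrite !proj_cat /proj filter_wpow => /esym/(wpow_comm_root n0).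
have -> : y = element z * (element w ^+ n ^+ i)^-1.
  by rewrite zE element_wpow mulgK.
apply: commuteM; last exact/commuteV/commuteX/commuteX.
by rewrite /commute -!element_cat; apply: trace_eq_element.
Qed.

(** The length of the powers of a nonempty cyclically reduced word grows. *)
Lemma expg_eq1 (g : raag E) n : 0 < n -> g ^+ n = 1 -> g = 1.
Proof.
move=> n0; have [w [k [cw ->]]] := conj_cyclically_reduced g.
rewrite -conjXg => /eqP; rewrite conjg_eq1 => /eqP wn; apply/eqP.
rewrite conjg_eq1; apply/eqP.
have : size (wpow w n) <= 0.
  by apply: (@size_reduced _ [::]); [exact: cw | rewrite element_wpow].
by rewrite size_wpow leqn0 muln_eq0 -leqn0 leqNgt n0 /= => /nilP->.
Qed.

(** * Centralizers *)

Definition vcount a w := count (fun l => l.1 == a) w.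

Lemma count_vertices (p : pred V) w :
  count (fun l => p l.1) w = \sum_(a | p a) vcount a w.
Proof.
elim: w => [|l w IHw] /=; first by rewrite big1.
rewrite big_split -IHw /=; congr (_ + _)%N.
case pl: (p l.1); last first.
  by rewrite big1 // => a pa; case: eqP => // la; rewrite -la pl in pa.
rewrite (bigD1 l.1) //= eqxx big1 // => a /andP[_].
by rewrite eq_sym => /negPf->.
Qed.

Lemma vcount_gt0 l w : l \in w -> 0 < vcount l.1 w.
Proof. by move=> lw; rewrite -has_count; apply/hasP; exists l. Qed.

(** If P and Q are the projections of [w] and [u], then P to the power [size Q]
    equals Q to the power [size P]. Counting the letters at [a] and at [b] in both
    shows that they occur in the same proportion in [w] and in [u]. *)
Lemma commuting_counts a b u w :
  trace_eq (u ++ w) (w ++ u) -> ~~ E a b ->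
  (vcount a w * vcount b u = vcount b w * vcount a u)%N.
Proof.
move=> uw ab; have := uw a b ab; rewrite !proj_cat => PQ.
have ratio x : x \in [:: a; b] ->
    (size (proj a b u) * vcount x w = size (proj a b w) * vcount x u)%N.
  rewrite !inE => xab.
  have vcE v : vcount x v = count (fun l => l.1 == x) (proj a b v).
    rewrite count_filter; apply: eq_count => l /=.
    by case: eqP => //= ->; rewrite xab.
  rewrite !vcE -!count_wpow; congr count.
  by apply: wpow_eq; rewrite // mulnC.
have := ratio a (mem_head _ _); have := ratio b; rewrite !inE eqxx orbT => /(_ isT).
have [u0|u0] := posnP (size (proj a b u)); last by nia.
have vc0 x : x \in [:: a; b] -> vcount x u = 0%N.
  rewrite !inE => cab; apply/eqP; rewrite -leqn0 -u0 size_filter sub_count // => l /=.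
  by move/eqP->.
by rewrite !vc0 ?inE ?eqxx ?orbT // !muln0.
Qed.

(** The vertices of the support of [w] and of its link: by [commuting_near] no
    other vertex occurs in a trace that commutes with [w]. *)
Definition near w a := 0 < vcount a w \/ forall b, 0 < vcount b w -> E a b.

Lemma commuting_near l u w :
  trace_eq (u ++ w) (w ++ u) -> l \in u -> near w l.1.
Proof.
move=> uw lu; have [wl|wl] := posnP (vcount l.1 w); last by left.
right=> b wb; apply: contraT => lb; have := commuting_counts uw lb.
rewrite wl mul0n => /esym/eqP; rewrite muln_eq0 !eqn0Ngt wb /=.
by rewrite vcount_gt0.
Qed.

(** The set [U] is a part of the support of [w] on which the complement of the
    graph is connected; connectedness is phrased through sets [P] that are closed
    under nonadjacency. The other vertices near [w] are central. A trace that
    commutes with [w] then has a positive power which is a power of [w] up to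
    central letters, and such powers commute with everything that commutes with
    [w]. *)
Lemma commute_near w y y' (U : pred V) :
    cyclically_reduced w ->
    {subset U <= [pred a | 0 < vcount a w]} ->
    (exists a, U a) ->
    (forall P : pred V, (exists2 a, U a & P a) ->
      (forall a b, U a -> U b -> P a -> ~~ E a b -> P b) ->
      forall b, U b -> P b) ->
    (forall a b, near w a -> near w b -> ~~ U a -> a = b \/ E a b) ->
  commute y (element w) -> commute y' (element w) -> commute y y'.
Proof.
move=> cw Uw [a0 Ua0] Uconn central yw y'w.
have near_w l : l \in w -> near w l.1 by move=> lw; left; apply: vcount_gt0.
pose R (s : seq (V * bool)) := [seq l <- s | ~~ U l.1].
pose inU (s : seq (V * bool)) := [seq l <- s | U l.1].
have commR s u : (forall l, l \in s -> near w l.1) ->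
    (forall l, l \in u -> near w l.1) -> commute (element u) (element (R s)).
  move=> ns nu; apply: commute_word => l; rewrite mem_filter => /andP[lU ls].
  apply/commute_sym/commute_word => c cu.
  case: (central l.1 c.1 (ns l ls) (nu c cu) lU); last exact: commute_letters.
  exact: commute_same_vertex.
(* Letters off [U] can be moved to the right of all others. *)
have decomp s : (forall l, l \in s -> near w l.1) ->
    element s = element (inU s) * element (R s).
  elim: s => [_|l s IHs ns]; first by rewrite mulg1.
  have ns' c : c \in s -> near w c.1 by move=> cs; apply: ns; rewrite in_cons cs orbT.
  rewrite element_cons IHs // /inU /R /=; case: ifP => Ul /=.
    by rewrite mulgA -element_cons.
  rewrite (element_cons l (filter _ _)) !mulgA; congr (_ * _).
  have := commR [:: l] (inU s); rewrite /R /= Ul /= => ->.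
  - by [].
  - by move=> c; rewrite inE => /eqP->; apply/ns/mem_head.
  - by move=> c; rewrite mem_filter => /andP[_]; apply: ns'.
have near_commR g s : commute g (element w) -> (forall l, l \in s -> near w l.1) ->
    commute g (element (R s)).
  move=> gw ns; have [k [z [zE zw]]] := commute_trace cw gw.
  have -> : g = element z * (element w ^+ k)^-1 by rewrite zE mulgK.
  have sR u : (forall l, l \in u -> near w l.1) ->
    commute (element (R s)) (element u) by move=> nu; apply/commute_sym/commR.
  apply/commute_sym/commuteM; last exact/commuteV/commuteX/sR.
  by apply: sR => l; apply: commuting_near.
have [k [z [zE zw]]] := commute_trace cw yw.
have nz l : l \in z -> near w l.1 by apply: commuting_near.
(* The ratio of the numbers of letters of [z] and of [w] at a vertex is the same
   at all vertices of [U], since it is the same at nonadjacent ones. *)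
have [i [j [i0 powU]]] : exists i j, 0 < i /\
    element (inU z) ^+ i = element (inU w) ^+ j.
  exists (vcount a0 w), (vcount a0 z); split; first exact: (Uw a0).
  have ratio : forall a, U a ->
      (vcount a0 w * vcount a z == vcount a0 z * vcount a w)%N.
    apply: Uconn; first by exists a0; rewrite // mulnC.
    move=> a b Ua Ub /eqP Pa ab; have := commuting_counts zw ab.
    have := Uw a Ua; rewrite inE; move: Pa; nia.
  rewrite -!element_wpow; apply: trace_eq_element => a b ab.
  have projU s : proj a b (inU s) = inU (proj a b s).
    by rewrite /proj /inU -!filter_predI; apply: eq_filter => l /=; rewrite andbC.
  rewrite /proj !filter_wpow -/(proj a b (inU z)) -/(proj a b (inU w)).
  apply: wpow_eq.
    have := congr1 inU (zw a b ab).
    by rewrite !proj_cat /inU !filter_cat -!/(inU _) -!projU.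
  rewrite /proj /inU -!filter_predI.
  rewrite !size_filter.
  rewrite !(count_vertices (predI (pred2 a b) U)) !big_distrr /=.
  by apply: eq_bigr => c /andP[_ Uc]; apply/eqP/ratio.
(* So [z ^+ i] is a power of [w] up to letters off [U], which are central. *)
have y'z : commute y' (element z ^+ i).
  rewrite (decomp z nz) expgMn; last first.
    by apply: commR => // l; rewrite mem_filter => /andP[_]; apply: nz.
  apply: commuteM; last exact/commuteX/near_commR.
  rewrite powU.
  have wU : element (inU w) = element w * (element (R w))^-1.
    by rewrite (decomp w near_w) mulgK.
  apply: commuteX; rewrite wU; apply: commuteM => //.
  exact/commuteV/near_commR.
have zy' : commute (element z) y' by apply: commute_root i0 _; apply: commute_sym.
have -> : y = element z * (element w ^+ k)^-1 by rewrite zE mulgK.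
apply/commute_sym/commuteM; first exact: commute_sym.
exact/commuteV/commuteX.
Qed.

Section TriangleSquareFree.
Hypotheses (triE : triangle_free E) (sqE : square_free E).

Lemma no_triangle (a b c : V) : E a b -> E b c -> E a c -> False.
Proof.
move=> ab bc ac; apply: triE.
pose f (i : 'I_3) := nth a [:: a; b; c] i.
have fE : {mono f : i j / cycle_graph i j >-> E i j}.
  case=> [[|[|[|i]]] ?] // [[|[|[|j]]] ?] //; rewrite /f /cycle_graph /=;
    by rewrite ?irrE // ?ab ?bc ?ac // symE ?ab ?bc ?ac.
exists f; split=> // i j fij; apply/eqP; apply: contraT => ij.
have : cycle_graph i j.
  by case: i j ij {fij} => [[|[|[|i]]] ?] // [[|[|[|j]]] ?].
by rewrite -fE fij irrE.
Qed.

Lemma no_square (a b c d : V) :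
  a != c -> b != d -> E a b -> E b c -> E c d -> E d a -> False.
Proof.
move=> ac bd ab bc cd da; apply: sqE.
have nac : E a c = false by apply/negP; apply: no_triangle bc.
have nbd : E b d = false by apply/negP; apply: no_triangle cd.
pose f (i : 'I_4) := nth a [:: a; b; c; d] i.
exists f; split; last first.
  case=> [[|[|[|[|i]]]] ?] // [[|[|[|[|j]]]] ?] //; rewrite /f /cycle_graph /=;
    by rewrite ?irrE // ?ab ?bc ?cd ?da ?nac ?nbd // symE ?ab ?bc ?cd ?da ?nac ?nbd.
have adj_neq x y : E x y -> x <> y by move=> + xy; rewrite xy irrE.
case=> [[|[|[|[|i]]]] ?] // [[|[|[|[|j]]]] ?] //; rewrite /f /= => eq_xy;
  by [apply: val_inj | rewrite eq_xy eqxx in ac | rewrite eq_xy eqxx in bd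
     | case: (adj_neq _ _ ab) | case: (adj_neq _ _ bc) | case: (adj_neq _ _ cd)
     | case: (adj_neq _ _ da)].
Qed.

(** Without triangles the leaves of the star are pairwise nonadjacent, and no
    vertex is adjacent to the centre and to a leaf. So [commute_near] applies with
    the leaves as [U]. *)
Lemma commute_star w (c : V) y y' :
    cyclically_reduced w -> 0 < vcount c w ->
    (exists2 a, a != c & 0 < vcount a w) ->
    (forall a, a != c -> 0 < vcount a w -> E c a) ->
  commute y (element w) -> commute y' (element w) -> commute y y'.
Proof.
move=> cw wc [a0 a0c wa0] star.
have near_supp a : near w a -> 0 < vcount a w.
  case=> // na; case: (no_triangle (na c wc) (star _ a0c wa0)).
  exact: na.
apply: (@commute_near _ _ _ (fun a => (a != c) && (0 < vcount a w))) => //.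
- by move=> a; rewrite inE => /andP[].
- by exists a0; rewrite a0c.
- move=> P [a /andP[ac wa] Pa] closed b /andP[bc wb].
  apply: (closed a) => //; rewrite ?ac ?bc //; apply/negP => ab.
  exact: no_triangle (star a ac wa) ab (star b bc wb).
- move=> a b /near_supp wa /near_supp wb; rewrite wa andbT negbK => /eqP->.
  by have [->|bc] := eqVneq b c; [left | right; apply: star].
Qed.

(** If the complement of the graph is connected on the support, take the whole
    support as [U]: two vertices of its link would form a triangle or a square
    with [a] and [b]. Otherwise the support is a join of two parts, and two
    vertices in each of them would form a square or a triangle, so that the
    support is a star. *)
Lemma commute_centralizer w a b y y' :
    cyclically_reduced w -> a != b -> 0 < vcount a w -> 0 < vcount b w ->
  commute y (element w) -> commute y' (element w) -> commute y y'.
Proof.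
move=> cw ab wa wb.
pose S x := 0 < vcount x w.
have [[P [[x Sx Px] [closed [z Sz nPz]]]]|conn] := pselect (exists P : pred V,
    (exists2 x, S x & P x) /\
    (forall x z, S x -> S z -> P x -> ~~ E x z -> P z) /\
    exists2 z, S z & ~~ P z).
  have join (u v : V) : S u -> S v -> P u -> ~~ P v -> E u v.
    by move=> Su Sv Pu; apply: contraR; apply: closed Su Sv Pu.
  have [single|] := pselect (forall u : V, S u -> P u -> u = x).
    apply: (@commute_star w x) => //.
      by exists z => //; apply: contraNneq nPz => ->.
    move=> u ux Su; apply: join => //; apply: contra_neqN ux; exact: single.
  move/existsNP => [x' /not_implyP[Sx' /not_implyP[Px' /eqP xx']]].
  apply: (@commute_star w z) => //.
    by exists x => //; apply: contraTneq Px => ->.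
  move=> u uz Su; rewrite symE; apply: (join u z) => //; apply: contraT => nPu.
  have x'z := join x' z Sx' Sz Px' nPz; have zx : E z x by rewrite symE join.
  have xu := join x u Sx Su Px nPu; have ux' : E u x' by rewrite symE join.
  by rewrite eq_sym in uz; case: (no_square xx' uz x'z zx xu ux').
apply: (@commute_near w _ _ S) => //.
- by exists a.
- move=> P PS closed u Su; apply: contraT => nPu; case: conn.
  by exists P; split=> //; split=> //; exists u.
- move=> u v [Su|uE]; first by rewrite /S Su.
  case=> [Sv|vE] _; first by right; apply: uE.
  have [->|uv] := eqVneq u v; [by left | right; exfalso].
  by apply: (no_square uv ab (uE a wa) _ (vE b wb)); rewrite symE ?uE ?vE.
Qed.

(** By [commute_centralizer] a cyclically reduced conjugate of [g] involves a
    single vertex. *)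
Theorem nonabelian_centralizer (g y y' : raag E) :
    commute y g -> commute y' g -> ~ commute y y' -> g <> 1 ->
  exists v h n, g = (raag_gen E v ^+ n) ^ h \/ g = (raag_gen E v ^- n) ^ h.
Proof.
have [w [h [cw ->]]] := conj_cyclically_reduced g.
rewrite -(conjgKV h y) -(conjgKV h y') !(@commute_conjg _ _ _ h) => yw y'w ny w1.
case: w cw yw y'w w1 => [_ _ _ []|[v s] w cw yw y'w _]; first exact: conj1g.
have wv : all (fun l => l.1 == v) ((v, s) :: w).
  apply/allP => l lw; apply: contra_notT ny => lv.
  apply: (commute_centralizer cw lv) => //; first exact: vcount_gt0.
  by rewrite /vcount /= eqxx.
have rw : reduced ((v, s) :: w) by have := cw 1%N; rewrite /wpow /= cats0.
have wE : (v, s) :: w = wpow [:: (v, s)] (size w).+1.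
  elim: w s {cw yw y'w} rw wv => // -[a t] w IHw s; rewrite wpowS.
  move=> /andP[+ rw] /andP[_ wv]; have /andP[/eqP /= av _] := wv.
  rewrite av in rw wv *; rewrite /= negb_or => /andP[vst _].
  have ts : t = s by apply/eqP; apply: contraR vst; case: (t) (s) => [] [].
  by rewrite -ts; congr (_ :: _); apply: (IHw t).
exists v, h, (size w).+1; rewrite wE element_wpow.
case: s {cw yw y'w rw wv wE} => [|]; last by left.
by right; rewrite -expVgn -(element_inv_letter (v, false)).
Qed.

End TriangleSquareFree.

(** * Exponent sums *)

Definition exponent_sum v (g : raag E) : int :=
  ((count_mem (v, false) (repr g))%:Z - (count_mem (v, true) (repr g))%:Z)%R.

Lemma word_eq_exponents v u w : word_eq u w ->
  (count_mem (v, false) u + count_mem (v, true) w =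
   count_mem (v, false) w + count_mem (v, true) u)%N.
Proof.
elim=> {u w}
  [w|u w _ ->|u s w _ IHu _ IHw|u u' w w' _ IHu _ IHw|x b|r [a [b [_ ->]]]].
- by [].
- by [].
- by lia.
- by rewrite !count_cat; lia.
- by case: b; rewrite /= !xpair_eqE !andbF !andbT; lia.
- by rewrite /= !xpair_eqE !andbF !andbT; lia.
Qed.

Lemma exponent_sum_element v w :
  exponent_sum v (element w) =
    ((count_mem (v, false) w)%:Z - (count_mem (v, true) w)%:Z)%R.
Proof.
have sub_eq (m n p q : nat) : (m + q = p + n)%N -> (m%:Z - n%:Z = p%:Z - q%:Z)%R.
  by lia.
apply/sub_eq/word_eq_exponents.
by apply/element_eq; rewrite /element reprK.
Qed.

Lemma exponent_sumM v g h :
  (exponent_sum v (g * h) = exponent_sum v g + exponent_sum v h)%R.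
Proof.
have [[u ->] [w ->]] := (elementP g, elementP h).
by rewrite -element_cat !exponent_sum_element !count_cat; lia.
Qed.

Lemma exponent_sum1 v : exponent_sum v 1 = 0%R.
Proof. exact: (exponent_sum_element v [::]). Qed.

Lemma exponent_sumV v g : exponent_sum v g^-1 = (- exponent_sum v g)%R.
Proof. have := exponent_sumM v g g^-1; rewrite mulgV exponent_sum1; lia. Qed.

Lemma exponent_sumX v g n : exponent_sum v (g ^+ n) = (n%:Z * exponent_sum v g)%R.
Proof.
elim: n => [|n IHn]; first by rewrite exponent_sum1; lia.
by rewrite expgS exponent_sumM IHn; lia.
Qed.

Lemma exponent_sum_conj (u v : V) g : exponent_sum u (raag_gen E v ^ g) = (u == v)%:Z%R.
Proof.
have gen : exponent_sum u (raag_gen E v) = ((u == v : nat)%:Z - 0%:Z)%R.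
  rewrite [LHS](exponent_sum_element u [:: (v, false)]).
  by congr (Posz _ - Posz _)%R; rewrite /= xpair_eqE eq_sym ?andbF // andbT addn0.
by rewrite !exponent_sumM exponent_sumV gen; lia.
Qed.

(** Let e be the exponent sum of [h] at [v] and p the conjugate of the generator.
    Since [h] commutes with p, h p^-e is a torsion element. *)
Lemma root_in_cyclic v g h n k :
  0 < n -> h ^+ n = (raag_gen E v ^ g) ^+ k -> exists e, h = (raag_gen E v ^ g) ^+ e.
Proof.
set p := raag_gen E v ^ g => n0 hn; exists `|exponent_sum v h|%N.
have ep : exponent_sum v p = 1%R by rewrite exponent_sum_conj eqxx.
have ek : (n * `|exponent_sum v h|)%N = k.
  have := congr1 (exponent_sum v) hn; rewrite !exponent_sumX ep GRing.mulr1.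
  by move/(congr1 absz); rewrite abszM !absz_nat.
apply/divg1_eq/(expg_eq1 n0).
rewrite expgnFl.
  by rewrite hn -expgnA mulnC ek mulgV.
have [k0|k0] := posnP k.
  move/eqP: ek; rewrite k0 muln_eq0 eqn0Ngt n0 => /eqP->.
  exact: commute1.
apply: commuteX; apply: commute_sym; apply: commute_root k0 _.
by rewrite -hn; apply/commute_sym/commuteX.
Qed.

(** The words ab and ba are reduced, but differ in their projection to the pair. *)
Lemma noncommuting_gens (a b : V) :
  a != b -> ~~ E a b -> ~ commute (raag_gen E a) (raag_gen E b).
Proof.
move=> neq_ab ab; rewrite /commute -!element_cat => comm.
have red x y : reduced [:: (x, false); (y, false)].
  by rewrite /= /inv_letter xpair_eqE !andbF.
have /(_ a b ab) := reduced_element (red a b) (red b a) comm.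
by rewrite /= !eqxx !orbT => -[ba]; rewrite ba eqxx in neq_ab.
Qed.

End Raag.

(** * The two extension graphs *)

Section ExtensionGraphs.
Local Open Scope group_scope.
Variables (V : finType) (E : rel V).
Hypotheses (symE : symmetric E) (irrE : irreflexive E).
Hypotheses (triE : triangle_free E) (sqE : square_free E).
Hypothesis degE : forall v : V, degree E v <> 0 /\ degree E v <> 1%N.
Variables (G : groupClosed (raag E)) (finG : finite_index G).
Local Notation A := (raag E).
Local Notation H := (subgroup_type G).
Implicit Types (p q : A) (c h : H).

Lemma ext_vertex_neq1 p : ext_vertices p -> p <> 1.
Proof.
case=> v [g ->] /(congr1 (exponent_sum v)).
by rewrite exponent_sum_conj exponent_sum1 eqxx.
Qed.

Lemma ext_vertex_root p g n k : ext_vertices p ->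
  0 < n -> g ^+ n = p ^+ k -> cyclic_subgroup p g.
Proof.
case=> v [h ->] n0 gn; have [e ->] := root_in_cyclic symE irrE n0 gn.
exact: cyclic_subgroupX.
Qed.

(** [p] is a root of a power of [q], hence a power of [q]; by exponent sums it is
    the first power. *)
Lemma ext_vertex_power_inj p q k : ext_vertices p -> ext_vertices q ->
  0 < k -> cyclic_subgroup q (p ^+ k) -> p = q.
Proof.
case=> v [g pE] [u [h qE]] k0.
have e_p : exponent_sum v p = 1%Z by rewrite pE exponent_sum_conj eqxx.
have e_q : exponent_sum v q = (v == u : nat) by rewrite qE exponent_sum_conj.
have {qE} roots g' n : g' ^+ k = q ^+ n -> exists e, g' = q ^+ e.
  by rewrite qE; apply: root_in_cyclic.
case=> n [/roots[e pq]|].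
  have := congr1 (exponent_sum v) pq; rewrite exponent_sumX e_p e_q.
  case: (v == u); last by lia.
  by move=> e1; rewrite pq; have -> : e = 1%N by lia.
move/(congr1 (@inv _)); rewrite invgK -expVgn => /roots[e pq].
by have := congr1 (exponent_sum v) pq; rewrite exponent_sumX exponent_sumV e_p e_q; lia.
Qed.

Lemma valX c n : val (c ^+ n) = val c ^+ n.
Proof. exact: gmulfXn. Qed.

Lemma commute_val c h : commute c h <-> commute (val c) (val h).
Proof.
split=> [ch|ch]; first exact: gmulf_commute.
by apply: val_inj; rewrite !gmulfM.
Qed.

Lemma cyclic_subgroup_val c h :
  cyclic_subgroup (val c) (val h) <-> cyclic_subgroup c h.
Proof.
split=> -[n hE]; exists n.
  case: hE => hE; [left | right]; apply: val_inj.
    by rewrite hE -valX.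
  by rewrite hE -valX -gmulfV.
case: hE => ->; [left; exact: valX | right; rewrite -valX].
exact: gmulfV.
Qed.

(** [c] generates the intersection of [G] with the cyclic subgroup of [p], and is
    a positive power of [p]. *)
Definition meet_gen p c := (exists2 k, 0 < k & val c = p ^+ k) /\
  forall h, cyclic_subgroup p (val h) -> cyclic_subgroup c h.

Lemma meet_gen_exists p : exists c, meet_gen p c.
Proof.
have exk : exists k, (0 < k) && (p ^+ k \in G).
  by have [k k0 Gk] := expg_in_finite_index p finG; exists k; rewrite k0.
(* The least positive [k] with [p ^+ k] in [G] divides all others. *)
case: (ex_minnP exk) => k /andP[k0 Gk] k_min.
exists (Sub (p ^+ k) Gk); split; first by exists k; rewrite ?SubK.
have kX n : p ^+ n \in G -> p ^+ n = p ^+ k ^+ (n %/ k).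
  rewrite {1 2}(divn_eq n k) expgnDr mulnC expgnA gpredMl => [Gr|]; last exact: gpredXn.
  have [->|r0] := posnP (n %% k); first by rewrite mulg1.
  have := k_min (n %% k); rewrite r0 Gr => /(_ isT).
  by rewrite leqNgt ltn_pmod.
move=> h [n hE]; apply/cyclic_subgroup_val; rewrite SubK.
have Gn : p ^+ n \in G.
  by have := valP h; case: hE => ->; rewrite ?gpredV.
by exists (n %/ k); rewrite -kX.
Qed.

Lemma meet_gen_unique p c d :
  meet_gen p c -> meet_gen p d -> cyclic_subgroup c = cyclic_subgroup d.
Proof.
move=> [[k _ cE] cP] [[l _ dE] dP].
apply: cyclic_subgroup_eq; [apply: cP | apply: dP].
  by rewrite dE; apply: cyclic_subgroupX.
by rewrite cE; apply: cyclic_subgroupX.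
Qed.

Lemma meet_gen_inj p q c d : ext_vertices p -> ext_vertices q ->
  meet_gen p c -> meet_gen q d -> cyclic_subgroup c = cyclic_subgroup d -> p = q.
Proof.
move=> extp extq [[k k0 cE] _] [[l _ dE] _] cd.
apply: (ext_vertex_power_inj extp extq k0); rewrite -cE.
apply: (@cyclic_subgroup_trans _ _ (val d)).
  by rewrite dE; apply: cyclic_subgroupX.
by apply/cyclic_subgroup_val; rewrite -cd; apply: cyclic_subgroup_id.
Qed.

Lemma meet_gen_commute p q c d :
  meet_gen p c -> meet_gen q d -> commute c d <-> commute p q.
Proof.
move=> [[k k0 cE] _] [[l l0 dE] _].
rewrite commute_val cE dE; split; last exact: commuteX2.
move/(commute_root symE irrE k0)/commute_sym/(commute_root symE irrE l0).
exact: commute_sym.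
Qed.

(** A cyclic subgroup that contains a nontrivial power of [p] is generated by a root
    of this power, thus by a power of [p]. *)
Lemma meet_gen_maximal p c : ext_vertices p -> meet_gen p c ->
  is_maximal_cyclic (cyclic_subgroup c).
Proof.
move=> extp [[k k0 cE] cP]; split=> [|D [h ->] sub_ch]; first by exists c.
have ch : cyclic_subgroup h c by apply/sub_ch/cyclic_subgroup_id.
apply: cyclic_subgroup_eq => //; apply: cP.
have nc : val c <> 1.
  by rewrite cE => /(expg_eq1 symE irrE k0); apply: ext_vertex_neq1.
case/cyclic_subgroup_val: ch => n hn.
have n0 : 0 < n.
  by case: n hn => // hn; case: nc; case: hn => ->; rewrite ?invg1.
case: hn => hn; first by apply: (ext_vertex_root extp n0 (k := k)); rewrite -hn.
rewrite -[val h]invgK; apply: cyclic_subgroupV.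
by apply: (ext_vertex_root extp n0 (k := k)); rewrite expVgn -hn.
Qed.

(** Let [a] and [b] be two neighbours of the vertex whose conjugate is [p]. Powers
    of their conjugates lie in [G] and commute with [c]; if they commuted with each
    other, then so would [a] and [b], which are not adjacent as there are no
    triangles. *)
Lemma meet_gen_nonabelian p c : ext_vertices p -> meet_gen p c ->
  ~ is_abelian (centralizer (cyclic_subgroup c)).
Proof.
case=> v [g ->] [[k k0 cE] _]; rewrite centralizer_cyclic => ab.
have /card_gt1P[a [b [va vb neq_ab]]] : 1 < #|[pred y | E v y]|.
  by have [] := degE v; rewrite /degree; case: #|_| => [|[]].
rewrite !inE in va vb.
have [n n0 Gn] := expg_in_finite_index (raag_gen E a ^ g) finG.
have [m m0 Gm] := expg_in_finite_index (raag_gen E b ^ g) finG.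
have cent u i (Gi : (raag_gen E u ^ g) ^+ i \in G) : E v u ->
    commute (Sub ((raag_gen E u ^ g) ^+ i) Gi : H) c.
  move=> vu; apply/commute_val; rewrite SubK cE; apply: commuteX2.
  by apply/commute_conjg/(@commute_letters _ _ (u, false) (v, false)); rewrite /= symE.
have /commute_val := ab _ _ (cent _ _ Gn va) (cent _ _ Gm vb).
rewrite !SubK => /(commute_root symE irrE n0)/commute_sym.
move/(commute_root symE irrE m0)/commute_sym/commute_conjg.
apply: noncommuting_gens => //.
by apply/negP => /(no_triangle symE irrE triE va)/(_ vb).
Qed.

(** A generator with nonabelian centralizer is a power of some vertex [p] of the
    extension graph, and by maximality there is no room between its cyclic subgroup
    and the intersection of [G] with that of [p]. *)
Lemma abs_ext_vertex_meet (C : set H) : abs_ext_vertices C ->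
  exists p c, [/\ ext_vertices p, meet_gen p c & C = cyclic_subgroup c].
Proof.
move=> [[[x ->] x_max]]; rewrite centralizer_cyclic.
move=> /existsNP[y /existsNP[y' /not_implyP[yx /not_implyP[y'x yy']]]].
(* The trivial subgroup is maximal cyclic only in the trivial group, which is
   abelian. *)
have x1 : val x <> 1.
  move=> x1; apply: yy'; suff -> : y = 1 by apply/commute_sym/commute1.
  have xy : (cyclic_subgroup y `<=` cyclic_subgroup x)%classic.
    rewrite (x_max (cyclic_subgroup y)) => [//||z]; first by exists y.
    have {x1} -> : x = 1 by apply: val_inj.
    by case=> n [] ->; rewrite ?expVgn expg1n ?invg1; exists 0%N; left.
  have /cyclic_subgroup_val[n] := xy y (cyclic_subgroup_id y).
  rewrite x1 expg1n invg1 => yE; apply: val_inj; by case: yE => ->.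
have [||||v [h [n xE]]] := nonabelian_centralizer symE irrE triE sqE
    (g := val x) (y := val y) (y' := val y').
- exact/commute_val.
- exact/commute_val.
- by move/commute_val.
- by [].
have extp : ext_vertices (raag_gen E v ^ h) by exists v, h.
have [c cP] := meet_gen_exists (raag_gen E v ^ h).
exists (raag_gen E v ^ h), c; split=> //; apply/esym/x_max; first by exists c.
move=> z; apply: cyclic_subgroup_trans; apply: (proj2 cP).
by exists n; rewrite -!conjXg -conjVg.
Qed.

Theorem abs_ext_graph_iso : graph_iso (@abs_ext_graph H) (@ext_graph V E).
Proof.
pose represents (P : @abs_ext_vertices H) (p : @ext_vertices V E) :=
  exists2 c, meet_gen (val p) c & val P = cyclic_subgroup c.
have extP (p : @ext_vertices V E) : ext_vertices (val p) by apply/set_mem/(valP p).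
have left_total P : exists p : @ext_vertices V E, represents P p.
  have [p [c [pE cP PE]]] := abs_ext_vertex_meet (set_mem (valP P)).
  by exists (SigSub (mem_set pE)), c.
have right_total (p : @ext_vertices V E) : exists P, represents P p.
  have [c cP] := meet_gen_exists (val p).
  have Pc : abs_ext_vertices (cyclic_subgroup c).
    split; first exact: (meet_gen_maximal (extP p)).
    exact: (meet_gen_nonabelian (extP p)).
  by exists (SigSub (mem_set Pc)), c.
have functional P (p q : @ext_vertices V E) : represents P p -> represents P q -> p = q.
  move=> [c cP Pc] [d dP Pd]; apply/val_inj.
  by apply: (meet_gen_inj (extP p) (extP q) cP dP); rewrite -Pc Pd.
have injective_rel P Q (p : @ext_vertices V E) :
    represents P p -> represents Q p -> P = Q.
  move=> [c cP Pc] [d dP Qd]; apply/val_inj; rewrite Pc Qd.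
  exact: meet_gen_unique cP dP.
have [f fP] := choice left_total.
have [g gP] := choice right_total.
exists f; split.
  exists g => [P|p]; last exact: functional (fP _) (gP _).
  exact: injective_rel (gP _) (fP _).
move=> P Q; rewrite /abs_ext_graph /ext_graph.
have [[c cP Pc] [d dQ Qd]] := (fP P, fP Q).
have -> : (f P != f Q) = (P != Q).
  congr (~~ _); apply/eqP/eqP => [fPQ|-> //].
  by apply: injective_rel (fP P) _; rewrite fPQ.
congr andb; apply/asboolP/asboolP => comm.
  move=> x y; rewrite Pc Qd => xE yE.
  have xc : cyclic_subgroup c x by rewrite xE; apply: cyclic_subgroup_id.
  have yd : cyclic_subgroup d y by rewrite yE; apply: cyclic_subgroup_id.
  apply: commute_cyclic_subgroup yd; apply: commute_sym.
  apply: commute_cyclic_subgroup xc; apply: commute_sym.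
  exact/(meet_gen_commute cP dQ).
by apply/(meet_gen_commute cP dQ)/comm.
Qed.

End ExtensionGraphs.

Theorem proposition7 (V : finType) (E : rel V)
    (symE : symmetric E) (irrE : irreflexive E)
    (connE : connected E)
    (triE : triangle_free E) (sqE : square_free E)
    (degE : forall v : V, degree E v <> 0 /\ degree E v <> 1)
    (G : groupClosed (raag E)) (finG : finite_index G) :
  graph_iso (@abs_ext_graph (subgroup_type G)) (@ext_graph V E).
Proof. exact (abs_ext_graph_iso symE irrE triE sqE degE finG). Qed.
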